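(* A maximum $6\times 6$ board contains twenty-two prisoners. That is, $P(6)=22$.
   Context: A configuration on an $n\times n$ board assigns to each of the $n^2$ squares exactly one occupant, either a prisoner or a guard. Two distinct squares are adjacent if one is directly above, below, to the left, to the right, or diagonal to the other (king-move adjacency). A configuration is valid (a valid board) if every square occupied by a prisoner is adjacent to at least as many squares occupied by guards as squares occupied by (other) prisoners. A maximum configuration (maximum board) is a valid board that has the greatest number of prisoners among all valid boards on the $n\times n$ board. $P(n)$ denotes the number of prisoners in a maximum configuration on the $n\times n$ board. *)

(* Defs.v *)
From mathcomp Require Import all_boot.

Set Implicit Arguments.
Unset Strict Implicit.
Unset Printing Implicit Defensive.

Definition square (n : nat) : finType := ('I_n * 'I_n)%type.

(* A configuration is encoded by its set of prisoners; every other square holds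
   a guard. *)
Definition configuration (n : nat) : finType := {set square n}.

Definition prisoners n (B : configuration n) : {set square n} := B.
Definition guards n (B : configuration n) : {set square n} := ~: B.

(* King-move adjacency: distinct squares whose row indices differ by at most 1
   and whose column indices differ by at most 1. *)
Definition adjacent n (x y : square n) : bool :=
  [&& x != y,
      x.1 <= y.1.+1, y.1 <= x.1.+1,
      x.2 <= y.2.+1 & y.2 <= x.2.+1].

Definition valid n (B : configuration n) : bool :=
  [forall x in prisoners B,
    #|[set y in prisoners B | adjacent x y]|
      <= #|[set y in guards B | adjacent x y]|].

Definition maximum n (B : configuration n) : bool :=
  valid B &&
  [forall C : configuration n, valid C ==> (#|prisoners C| <= #|prisoners B|)].

Definition P (n : nat) : nat :=
  \max_(B : configuration n | valid B) #|prisoners B|.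

(* Main.v *)
(* If there were 23 prisoners, then by the symmetry exchanging the top and bottom
   halves some 3x6 half, say the top one, would hold at least 12. An exhaustive
   search over the three rows shows that the conditions on the first two of them
   leave a single possibility: full, empty, full. A second search shows that the
   bottom half then holds at most 10, a total of at most 22. *)
Require Import Defs.
From mathcomp Require Import all_boot zify.

Set Implicit Arguments.
Unset Strict Implicit.
Unset Printing Implicit Defensive.

(** * Boards as lists of rows of booleans *)

(* The entries of [s] at distance at most 1 from position [j]. *)
Definition window T (j : nat) (s : seq T) : seq T := drop j.-1 (take j.+2 s).

Definition block (j : nat) (rs : seq bitseq) : bitseq :=
  flatten [seq window j r | r <- rs].

(* The block contains the prisoner itself, hence the successor. *)
Definition balanced (s : bitseq) : bool := count id s <= (count negb s).+1.

(** Here [rs] is meant to hold [r] itself together with the rows directly above and below it. *)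
Definition row_ok (rs : seq bitseq) (r : bitseq) : bool :=
  all (fun j => nth false r j ==> balanced (block j rs)) (iota 0 (size r)).

Definition rows_ok (M : seq bitseq) : bool :=
  all (fun i => row_ok (window i M) (nth [::] M i)) (iota 0 (size M)).

Definition weight (rs : seq bitseq) : nat := sumn [seq count id r | r <- rs].

Definition board_rows n (B : configuration n) : seq bitseq :=
  [seq [seq (u, v) \in B | v <- enum 'I_n] | u <- enum 'I_n].

Lemma map_window T U (f : T -> U) j (s : seq T) :
  [seq f x | x <- window j s] = window j [seq f x | x <- s].
Proof. by rewrite /window map_drop map_take. Qed.

Lemma mem_window_enum n (i u : 'I_n) :
  (u \in window i (enum 'I_n)) = (i <= u.+1) && (u <= i.+1).
Proof.
rewrite -(mem_map val_inj) map_window val_enum_ord /window take_iota drop_iota.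
rewrite mem_iota.
(* The case [i = 0] is split off because the predecessor in [window] truncates there. *)
by case: i u => [[|i] Hi] [u Hu] /=; lia.
Qed.

Lemma window_uniq (T : eqType) j (s : seq T) : uniq s -> uniq (window j s).
Proof. by move=> us; rewrite drop_uniq ?take_uniq. Qed.

(** The closed neighbourhood, [x] included, listed in the order in which [block] reads it. *)
Definition neighbourhood n (x : square n) : seq (square n) :=
  [seq (u, v) | u <- window x.1 (enum 'I_n), v <- window x.2 (enum 'I_n)].

Lemma neighbourhood_uniq n (x : square n) : uniq (neighbourhood x).
Proof.
by apply: allpairs_uniq => [||[? ?] [? ?] _ _ [-> ->] //];
  exact/window_uniq/enum_uniq.
Qed.

Lemma mem_neighbourhood n (x y : square n) :
  (y \in neighbourhood x) = (y == x) || adjacent x y.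
Proof.
have -> : (y \in neighbourhood x) =
    [&& x.1 <= y.1.+1, y.1 <= x.1.+1, x.2 <= y.2.+1 & y.2 <= x.2.+1].
  rewrite andbA -!mem_window_enum; case: y => u v.
  by apply/allpairsP/andP => [[[u' v'] [? ? [-> ->]]] | [? ?]];
    last exists (u, v).
rewrite /adjacent eq_sym; case: eqP => //= ->.
by rewrite !leqnSn.
Qed.

(** The list has no repetition, so counting in it gives a cardinality; [x] is split off because it
    is not adjacent to itself. *)
Lemma count_neighbourhood n (A : {set square n}) (x : square n) :
  count [in A] (neighbourhood x) = (x \in A) + #|[set y in A | adjacent x y]|.
Proof.
rewrite -size_filter -(card_uniqP (filter_uniq _ (neighbourhood_uniq x))).
have -> : #|[seq y <- neighbourhood x | y \in A]|
    = #|[set y in A | y \in neighbourhood x]|.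
  by apply: eq_card => y; rewrite mem_filter !inE.
rewrite (cardsD1 x) !inE mem_neighbourhood eqxx andbT; congr (_ + _).
apply: eq_card => y; rewrite !inE mem_neighbourhood.
by case: eqVneq => [->|] //=; rewrite /adjacent eqxx andbF.
Qed.

Lemma block_board_rows n (B : configuration n) (x : square n) :
  block x.2 (window x.1 (board_rows B)) =
  [seq y \in B | y <- neighbourhood x].
Proof.
rewrite /block /board_rows -map_window -map_comp map_flatten -map_comp.
by congr flatten; apply: eq_map => u; rewrite /= -map_window -map_comp.
Qed.

(** The prisoner on [x] adds one to the count of prisoners and nothing to that of guards, which the
    successor in [balanced] offsets. *)
Lemma balanced_board_rows n (B : configuration n) (x : square n) :
  x \in B ->
  balanced (block x.2 (window x.1 (board_rows B))) =
  (#|[set y in prisoners B | adjacent x y]| <=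
   #|[set y in guards B | adjacent x y]|).
Proof.
move=> xB; rewrite block_board_rows /balanced !count_map.
rewrite (@eq_count _ _ [in B]) // count_neighbourhood xB.
rewrite (@eq_count _ _ [in ~: B]); last by move=> y; rewrite /= inE.
by rewrite count_neighbourhood inE xB.
Qed.

Lemma size_board_rows n (B : configuration n) : size (board_rows B) = n.
Proof. by rewrite size_map size_enum_ord. Qed.

Lemma nth_board_rows n (B : configuration n) (i : 'I_n) :
  nth [::] (board_rows B) i = [seq (i, v) \in B | v <- enum 'I_n].
Proof. by rewrite (nth_map i) ?size_enum_ord // nth_ord_enum. Qed.

(** Carries validity over to lists, where it can be decided by evaluation. *)
Lemma valid_rows_ok n (B : configuration n) :
  valid B = rows_ok (board_rows B).
Proof.
have nthB (i j : 'I_n) :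
    nth false (nth [::] (board_rows B) i) j = ((i, j) \in B).
  by rewrite nth_board_rows (nth_map j) ?size_enum_ord // nth_ord_enum.
have size_row (i : 'I_n) : size (nth [::] (board_rows B) i) = n.
  by rewrite nth_board_rows size_map size_enum_ord.
apply/forall_inP/allP => [vB i | okB [i j] ijB].
  rewrite mem_iota size_board_rows => /= lti.
  apply/allP => j; rewrite mem_iota (size_row (Ordinal lti)) => /= ltj.
  apply/implyP; rewrite (nthB (Ordinal lti) (Ordinal ltj)) => ijB.
  by rewrite (balanced_board_rows ijB) vB.
rewrite -balanced_board_rows //=.
have /okB/allP/(_ j) : (i : nat) \in iota 0 (size (board_rows B)).
  by rewrite mem_iota size_board_rows ltn_ord.
by rewrite mem_iota size_row ltn_ord nthB ijB => /(_ isT).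
Qed.

Lemma card_board_rows n (B : configuration n) : #|B| = weight (board_rows B).
Proof.
rewrite /weight sumnE 2!big_map -sum1_card.
rewrite (eq_bigl (fun x => (x.1, x.2) \in B)); last by case.
rewrite -(pair_big_dep xpredT (fun u v => (u, v) \in B) (fun _ _ => 1)) /=.
rewrite big_enum; apply: eq_bigr => u _.
by rewrite count_map -sum1_count big_enum_cond /=.
Qed.

(** * Exhaustive searches over rows *)

Fixpoint bitseqs (n : nat) : seq bitseq :=
  if n is m.+1 then
    [seq true :: s | s <- bitseqs m] ++ [seq false :: s | s <- bitseqs m]
  else [:: [::]].

Lemma mem_bitseqs (s : bitseq) : s \in bitseqs (size s).
Proof.
by elim: s => //= -[] s IHs; rewrite mem_cat map_f ?orbT.
Qed.

(** Draws a statement on an arbitrary row from a search settled by computation. *)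
Lemma all_bitseqs n (p : pred bitseq) s :
  all p (bitseqs n) -> size s = n -> p s.
Proof. by move=> /allP pn sn; apply: pn; rewrite -sn mem_bitseqs. Qed.

(** Turning the board upside down only permutes the rows of a block, and [balanced] depends on
    counts alone. *)
Lemma row_ok_rev rs r : row_ok (rev rs) r = row_ok rs r.
Proof.
apply: eq_all => j; congr (_ ==> _); rewrite /balanced /block map_rev.
set ws := [seq window j r0 | r0 <- rs].
by have /permP eq_cnt := perm_flatten (permEl (perm_rev ws)); rewrite !eq_cnt.
Qed.

Definition full_row := nseq 6 true.
Definition empty_row := nseq 6 false.

Lemma heavy_half a b c : size a = 6 -> size b = 6 -> size c = 6 ->
    row_ok [:: a; b] a -> row_ok [:: a; b; c] b -> 12 <= weight [:: a; b; c] ->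
  [:: a; b; c] = [:: full_row; empty_row; full_row].
Proof.
move=> sa sb sc oka okb wabc.
(* The third row adds at most 6, whence the pruning at 6 = 12 - 6; similarly
   5 = 11 - 6 below. *)
suff: all (fun a => all (fun b =>
    (* Under the call by value of [vm_compute], [if] enters the inner search only when the test
       succeeds, whereas [==>] would always run it. *)
    if (6 <= weight [:: a; b]) && row_ok [:: a; b] a then all (fun c =>
      if (12 <= weight [:: a; b; c]) && row_ok [:: a; b; c] b then
        [:: a; b; c] == [:: full_row; empty_row; full_row]
      else true) (bitseqs 6)
    else true) (bitseqs 6)) (bitseqs 6).
  move=> /all_bitseqs/(_ sa)/all_bitseqs/(_ sb).
  have -> : 6 <= weight [:: a; b].
    have := count_size id c; move: wabc; rewrite /weight /= sc; lia.
  rewrite oka => /all_bitseqs/(_ sc).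
  by rewrite wabc okb => /eqP.
by vm_compute.
Qed.

(** Between an empty row and [d], the condition on the full row says that every window of [d]
    contains a guard; this prunes the search before [e] and [f] are chosen. *)
Lemma heavy_extension d e f : size d = 6 -> size e = 6 -> size f = 6 ->
    row_ok [:: empty_row; full_row; d] full_row ->
    row_ok [:: full_row; d; e] d ->
    row_ok [:: d; e; f] e -> row_ok [:: e; f] f ->
  weight [:: d; e; f] <= 10.
Proof.
move=> sd se sf okc okd oke okf.
suff: all (fun d =>
    if row_ok [:: empty_row; full_row; d] full_row then all (fun e =>
      if (5 <= weight [:: d; e]) && row_ok [:: full_row; d; e] d then
        all (fun f => row_ok [:: d; e; f] e && row_ok [:: e; f] f ==>
          (weight [:: d; e; f] <= 10)) (bitseqs 6)
      else true) (bitseqs 6)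
    else true) (bitseqs 6).
  move=> /all_bitseqs/(_ sd); rewrite okc => /all_bitseqs/(_ se).
  rewrite okd andbT; case: (leqP 5 (weight [:: d; e])) => [_|wde _].
    by move=> /all_bitseqs/(_ sf); rewrite oke okf.
  have := count_size id f; move: wde; rewrite /weight /= sf; lia.
by vm_compute.
Qed.

(** * The upper bound *)

Lemma weight_cat rs1 rs2 : weight (rs1 ++ rs2) = weight rs1 + weight rs2.
Proof. by rewrite /weight map_cat sumn_cat. Qed.

Lemma weight_heavy_top a b c d e f :
    [/\ size a = 6, size b = 6 & size c = 6] ->
    [/\ size d = 6, size e = 6 & size f = 6] ->
    row_ok [:: a; b] a -> row_ok [:: a; b; c] b -> row_ok [:: b; c; d] c ->
    row_ok [:: c; d; e] d -> row_ok [:: d; e; f] e ->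
    row_ok [:: e; f] f -> 12 <= weight [:: a; b; c] ->
  weight [:: a; b; c] + weight [:: d; e; f] <= 22.
Proof.
move=> [sa sb sc] [sd se sf] oka okb okc okd oke okf wabc.
have [-> eb ec] := heavy_half sa sb sc oka okb wabc.
move: okc okd; rewrite eb ec => okc okd.
(* The top half evaluates to 12, and 22 is 12 + 10. *)
exact: (leq_add (leqnn 12) (heavy_extension sd se sf okc okd oke okf)).
Qed.

Lemma weight_rev rs : weight (rev rs) = weight rs.
Proof. by rewrite /weight map_rev sumn_rev. Qed.

Lemma weight_rows_ok M :
  size M = 6 -> {in M, forall r, size r = 6} -> rows_ok M -> weight M <= 22.
Proof.
case: M => [|a [|b [|c [|d [|e [|f []]]]]]] // _ sM.
have [sa sb sc] : [/\ size a = 6, size b = 6 & size c = 6].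
  by split; apply: sM; rewrite !inE eqxx ?orbT.
have [sd se sf] : [/\ size d = 6, size e = 6 & size f = 6].
  by split; apply: sM; rewrite !inE eqxx ?orbT.
rewrite /rows_ok /= => /and5P[oka okb okc okd /and3P[oke okf _]].
rewrite (weight_cat [:: a; b; c] [:: d; e; f]).
have [wabc|wabc] := leqP 12 (weight [:: a; b; c]).
  exact: weight_heavy_top.
have [wdef|wdef] := leqP 12 (weight [:: d; e; f]); last by lia.
(* The bottom half is the heavy one: the board is read upside down, as [f], [e], [d], [c], [b],
   [a]. *)
rewrite addnC -(weight_rev [:: a; b; c]) -(weight_rev [:: d; e; f]).
apply: weight_heavy_top => //; rewrite -1?row_ok_rev //.
by rewrite -(weight_rev [:: d; e; f]) in wdef.
Qed.

Lemma card_valid (B : configuration 6) : valid B -> #|B| <= 22.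
Proof.
rewrite valid_rows_ok card_board_rows; apply: weight_rows_ok.
  exact: size_board_rows.
by move=> r /mapP[u _ ->]; rewrite size_map size_enum_ord.
Qed.

(** * A valid board with 22 prisoners *)

(** Two columns of guards leave 24 squares; two further guards in the third column are placed so
    that each prisoner of the fourth is adjacent to exactly one of them. *)
Definition optimal_rows : seq bitseq :=
  let thin := [:: true; false; true; true; false; true] in
  let thinner := [:: true; false; false; true; false; true] in
  [:: thin; thinner; thin; thin; thinner; thin].

Definition optimal_board : configuration 6 :=
  [set x : square 6 | nth false (nth [::] optimal_rows x.1) x.2].

Lemma board_rows_optimal : board_rows optimal_board = optimal_rows.
Proof.
(* Indexing by [iota] in place of the ordinals lets the comparison with the explicit rows be settled
   by evaluation. *)
transitivity
    [seq [seq nth false (nth [::] optimal_rows i) j | j <- iota 0 6] |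
      i <- iota 0 6]; last by [].
rewrite -val_enum_ord -map_comp; apply: eq_map => u /=.
by rewrite -map_comp; apply: eq_map => v; rewrite /= inE.
Qed.

Lemma valid_optimal : valid optimal_board.
Proof. by rewrite valid_rows_ok board_rows_optimal; vm_compute. Qed.

Lemma card_optimal : #|optimal_board| = 22.
Proof. by rewrite card_board_rows board_rows_optimal. Qed.

Theorem proposition3p4 :
  (forall B : configuration 6, maximum B -> #|prisoners B| = 22) /\ P 6 = 22.
Proof.
split=> [B /andP[vB /forallP maxB]|].
  (* For the lower bound, [optimal_board] is the competitor that [B] must match. *)
  apply/eqP; rewrite eqn_leq card_valid //= -card_optimal.
  exact: (implyP (maxB optimal_board) valid_optimal).
apply/eqP; rewrite eqn_leq; apply/andP; split.
  by apply/bigmax_leqP => B; apply: card_valid.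
by rewrite -[leqLHS]card_optimal; apply: leq_bigmax_cond valid_optimal.
Qed.
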